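(* $\mathrm{S}^{\neq}$ and $\mathrm{S}^{=}$ are closed under reversal.
   Context: Let $\Gamma=\Sigma\cup\{¢,\$\}$, where ¢ and \$ are left and right end-markers. A PFA $\mathcal{P}=(S,\Sigma,\{\mathsf{A}_\sigma:\sigma\in\Gamma\},F)$ has states $S=\{s_1,\dots,s_n\}$ (start state $s_1$), real stochastic $n\times n$ transition matrices $\mathsf{A}_\sigma$, and accepting states $F$; its acceptance probability on $w\in\Sigma^*$ is $f_{\mathcal{P}}(w)=\sum_{s_i\in F}\mathsf{v}(i)$, where $\mathsf{v}=(1,0,\dots,0)\mathsf{A}_{¢}\mathsf{A}_{w_1}\cdots\mathsf{A}_{w_{|w|}}\mathsf{A}_{\$}$. $\mathrm{S}^{=}$ is the class of languages $\{w: f_{\mathcal{P}}(w)=\lambda\}$ and $\mathrm{S}^{\neq}$ the class of languages $\{w: f_{\mathcal{P}}(w)\neq\lambda\}$, for some PFA $\mathcal{P}$ and $\lambda\in[0,1]$. *)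

(* Defs.v *)
From mathcomp Require Import all_boot all_order all_algebra.
From mathcomp Require Import boolp classical_sets reals.

Set Implicit Arguments.
Unset Strict Implicit.
Unset Printing Implicit Defensive.

Import Order.TTheory GRing.Theory Num.Theory.
Local Open Scope classical_set_scope.
Local Open Scope ring_scope.

Variant tape_symbol (Sigma : Type) : Type :=
  | LeftEnd
  | Letter of Sigma
  | RightEnd.

Arguments LeftEnd {Sigma}.
Arguments RightEnd {Sigma}.

Definition tape (Sigma : Type) (w : seq Sigma) : seq (tape_symbol Sigma) :=
  LeftEnd :: rcons (map (@Letter Sigma) w) RightEnd.

(* Distributions over states are row vectors, acted on from the right, so a
   stochastic matrix is one whose rows are probability vectors. *)
Definition stochastic (R : realType) (n : nat) (A : 'M[R]_n) : Prop :=
  (forall i j, 0 <= A i j) /\ (forall i, \sum_j A i j = 1).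

(* The states are 'I_(pfa_dim.+1): there is at least one, and the start state
   is ord0. *)
Record PFA (R : realType) (Sigma : finType) : Type := MkPFA {
  pfa_dim : nat;
  pfa_trans : tape_symbol Sigma -> 'M[R]_(pfa_dim.+1);
  pfa_accept : {set 'I_(pfa_dim.+1)};
  pfa_stochastic : forall a, stochastic (pfa_trans a)
}.

Definition final_vector (R : realType) (Sigma : finType) (P : PFA R Sigma)
    (w : seq Sigma) : 'rV[R]_((pfa_dim P).+1) :=
  foldl (fun v a => v *m pfa_trans P a) (delta_mx 0 ord0) (tape w).

Definition acceptance_prob (R : realType) (Sigma : finType) (P : PFA R Sigma)
    (w : seq Sigma) : R :=
  \sum_(i in pfa_accept P) final_vector P w 0 i.

Definition S_eq (R : realType) (Sigma : finType) : set (set (seq Sigma)) :=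
  [set L | exists (P : PFA R Sigma) (lambda : R),
     0 <= lambda <= 1 /\ L = [set w | acceptance_prob P w = lambda]].

Definition S_neq (R : realType) (Sigma : finType) : set (set (seq Sigma)) :=
  [set L | exists (P : PFA R Sigma) (lambda : R),
     0 <= lambda <= 1 /\ L = [set w | acceptance_prob P w <> lambda]].

Definition reversal (Sigma : finType) (L : set (seq Sigma)) : set (seq Sigma) :=
  [set rev w | w in L].

Definition closed_under_reversal (Sigma : finType)
    (C : set (set (seq Sigma))) : Prop :=
  forall L, C L -> C (reversal L).

(* Main.v *)
(* Transposing f_P (rev w) = e_0 A_¢ A_(w_k) ... A_(w_1) A_$ 1_F turns it into
   the value on w of an automaton with nonnegative, but no longer stochastic,
   initial vector and matrices. An additional state with a self-loop
   subtracts lambda from this value. Scaling makes the vector and the matrices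
   substochastic, and a sink state accepted with probability 1/2 absorbs the
   missing mass: the resulting PFA accepts w with probability
   1/2 + a b^|w| (f_P (rev w) - lambda) for some a, b > 0, so that comparing it
   with the cutpoint 1/2 amounts to comparing f_P (rev w) with lambda. *)
Require Import Defs.
From mathcomp Require Import all_boot all_order all_algebra.
From mathcomp Require Import boolp classical_sets reals.
From mathcomp Require Import ring lra.

Set Implicit Arguments.
Unset Strict Implicit.
Unset Printing Implicit Defensive.

Import Order.TTheory GRing.Theory Num.Theory.
Local Open Scope ring_scope.

Definition mxword (R : realType) (T : Type) m (B : T -> 'M[R]_m) (w : seq T) :
    'M[R]_m :=
  foldr (fun a N => B a *m N) 1%:M w.

Lemma foldl_mulmx (R : realType) (T : Type) m (B : T -> 'M[R]_m)
    (v : 'rV[R]_m) (w : seq T) :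
  foldl (fun v a => v *m B a) v w = v *m mxword B w.
Proof.
elim: w v => [|a w IHw] v /=; first by rewrite mulmx1.
by rewrite IHw mulmxA.
Qed.

Lemma mxword_cat (R : realType) (T : Type) m (B : T -> 'M[R]_m) (s t : seq T) :
  mxword B (s ++ t) = mxword B s *m mxword B t.
Proof. by elim: s => [|a s IHs] /=; rewrite ?mul1mx // IHs mulmxA. Qed.

Lemma mxword_map (R : realType) (S T : Type) m (h : S -> T) (B : T -> 'M[R]_m)
    (w : seq S) :
  mxword B (map h w) = mxword (B \o h) w.
Proof. by elim: w => //= a w ->. Qed.

(** Transposition reverses the order of a product: this is where the reversed word enters. *)
Lemma mxword_tr (R : realType) (T : Type) m (B : T -> 'M[R]_m) (w : seq T) :
  mxword (fun a => (B a)^T) w = (mxword B (rev w))^T.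
Proof.
elim: w => [|a w IHw]; first by rewrite trmx1.
by rewrite rev_cons -cats1 mxword_cat /= mulmx1 trmx_mul -IHw.
Qed.

Lemma mxword_scale (R : realType) (T : Type) m (c : R) (B : T -> 'M[R]_m)
    (w : seq T) :
  mxword (fun a => c *: B a) w = c ^+ size w *: mxword B w.
Proof.
elim: w => [|a w IHw] /=; first by rewrite scale1r.
by rewrite IHw -scalemxAl -scalemxAr scalerA exprS.
Qed.

Lemma mxword_block_diag (R : realType) (T : Type) m n (B : T -> 'M[R]_m)
    (C : T -> 'M[R]_n) (w : seq T) :
  mxword (fun a => block_mx (B a) 0 0 (C a)) w
  = block_mx (mxword B w) 0 0 (mxword C w).
Proof.
elim: w => [|a w IHw] /=; first by rewrite -scalar_mx_block.
by rewrite IHw mulmx_block !(mul0mx, mulmx0, addr0, add0r).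
Qed.

Lemma mxword_const1 (R : realType) (T : Type) m (w : seq T) :
  mxword (fun=> 1%:M : 'M[R]_m) w = 1%:M.
Proof. by elim: w => //= a w ->; rewrite mulmx1. Qed.

(** A row times a product along [w] times a column is a shape that transposition preserves. *)
Lemma acceptance_probE (R : realType) (Sigma : finType) (P : PFA R Sigma)
    (w : seq Sigma) :
  acceptance_prob P w =
  (row ord0 (pfa_trans P LeftEnd) *m mxword (pfa_trans P \o @Letter Sigma) w
   *m (pfa_trans P RightEnd *m \col_i (i \in pfa_accept P)%:R)) 0 0.
Proof.
rewrite /acceptance_prob /final_vector /tape foldl_mulmx /= -cats1 mxword_cat.
rewrite mxword_map /= mulmx1 !mulmxA -rowE.
rewrite big_mkcond [RHS]mxE; apply: eq_bigr => i _.
by rewrite [X in _ = _ * X]mxE; case: (i \in _); rewrite ?mulr1 ?mulr0.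
Qed.

(* Reading the left end-marker jumps to distribution [p] from every state;
   reading the right one moves from state i to the accepting state [ord0] with
   probability [q i] and to [ord_max] otherwise. *)
Lemma PFA_of_final_weights (R : realType) (Sigma : finType) m
    (p : 'rV[R]_m.+2) (M : Sigma -> 'M[R]_m.+2) (q : 'cV[R]_m.+2) :
  (forall j, 0 <= p 0 j) -> \sum_j p 0 j = 1 -> (forall a, stochastic (M a)) ->
  (forall i, 0 <= q i 0 <= 1) ->
  exists P : PFA R Sigma, forall w,
    acceptance_prob P w = (p *m mxword M w *m q) 0 0.
Proof.
move=> p0 p1 Mst q01.
pose A (a : tape_symbol Sigma) : 'M[R]_m.+2 :=
  match a with
  | LeftEnd => \matrix_(i, j) p 0 j
  | Letter a => M a
  | RightEnd => \matrix_(i, j)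
      (q i 0 *+ (j == ord0) + (1 - q i 0) *+ (j == ord_max))
  end.
have Ast a : stochastic (A a).
  case: a => [|a|] //=; split=> i => [j|]; rewrite ?mxE //.
  - by rewrite -[RHS]p1; apply: eq_bigr => j _; rewrite mxE.
  - by have /andP[? ?] := q01 i; rewrite addr_ge0 ?mulrn_wge0 ?subr_ge0.
  under eq_bigr do rewrite mxE.
  (* The dimension [m.+2] makes [ord0] and [ord_max] distinct. *)
  rewrite (bigD1 ord0) //= (bigD1 ord_max) //= big1 => [|j /andP[j0 jm]].
    by rewrite eqxx !mulr1n mulr0n add0r !addr0 subrKC.
  by rewrite (negPf j0) (negPf jm) addr0.
exists (MkPFA [set ord0] Ast) => w; rewrite acceptance_probE /=.
congr ((_ *m _ *m _) 0 0); apply/matrixP=> i j; rewrite !mxE ?(ord1 i) //.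
rewrite (bigD1 ord0) //= big1 => [|k k0]; rewrite !mxE !inE.
  by rewrite eqxx addr0 mulr1 addr0 (ord1 j).
by rewrite (negPf k0) mulr0.
Qed.

(** An absorbing state put at index 0 receives the deficit of [x] and of each row of [B]. The final
    weights are 1/2 there and (1 + [y i 0])/2 elsewhere, which lie in [0,1] even for negative
    [y i 0]. *)
Lemma PFA_of_substochastic (R : realType) (Sigma : finType) m
    (x : 'rV[R]_m.+1) (B : Sigma -> 'M[R]_m.+1) (y : 'cV[R]_m.+1) :
  (forall j, 0 <= x 0 j) -> \sum_j x 0 j <= 1 ->
  (forall a i j, 0 <= B a i j) -> (forall a i, \sum_j B a i j <= 1) ->
  (forall i, `|y i 0| <= 1) ->
  exists P : PFA R Sigma, forall w,
    acceptance_prob P w = 2^-1 + 2^-1 * (x *m mxword B w *m y) 0 0.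
Proof.
move=> x0 x1 B0 B1 y1.
pose p : 'rV[R]_(1 + m.+1) := row_mx (1 - \sum_j x 0 j)%:M x.
pose M a : 'M[R]_(1 + m.+1) :=
  block_mx 1%:M 0 (\col_i (1 - \sum_j B a i j)) (B a).
pose q : 'cV[R]_(1 + m.+1) := const_mx 2^-1 + 2^-1 *: col_mx 0 y.
have p0 j : 0 <= p 0 j.
  by rewrite mxE; case: split => k //; rewrite mxE (ord1 k) subr_ge0.
have p1 : \sum_j p 0 j = 1.
  rewrite /p big_split_ord big_ord1 /= row_mxEl mxE /=.
  rewrite mulr1n [X in _ + X](eq_bigr (x 0)) ?subrK // => j _.
  by rewrite row_mxEr.
have Mst a : stochastic (M a).
  split=> i => [j|].
    rewrite mxE; case: split => k; rewrite mxE; case: split => l;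
      by rewrite ?mxE ?ler0n ?subr_ge0.
  rewrite /M big_split_ord big_ord1 /=; case: (split_ordP i) => k ->.
    rewrite block_mxEul mxE (ord1 k) eqxx big1 ?addr0 // => j _.
    by rewrite block_mxEur mxE.
  rewrite block_mxEdl mxE [X in _ + X](eq_bigr (B a k)) ?subrK // => j _.
  by rewrite block_mxEdr.
have q01 i : 0 <= q i 0 <= 1.
  rewrite !mxE; case: split => k; first by rewrite mxE mulr0; lra.
  by have := y1 k; rewrite ler_norml; lra.
have [P PE] := PFA_of_final_weights p0 p1 Mst q01.
exists P => w; rewrite PE mulmxDr -scalemxAr.
(* Stochastic matrices fix the all-ones column, so the constant part of [q] contributes exactly
   1/2. *)
have Mw1 : mxword M w *m const_mx 1 = const_mx 1 :> 'cV[R]_(1 + m.+1).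
  elim: w => [|a w IHw] /=; first by rewrite mul1mx.
  rewrite -mulmxA IHw; apply/colP=> i; rewrite !mxE -[RHS](proj2 (Mst a) i).
  by apply: eq_bigr => j _; rewrite [X in _ * X]mxE mulr1.
have -> : const_mx 2^-1 = 2^-1 *: const_mx 1 :> 'cV[R]_(1 + m.+1).
  by apply/colP=> i; rewrite !mxE mulr1.
rewrite -scalemxAr -[p *m _ *m const_mx 1]mulmxA Mw1.
have -> : p *m const_mx 1 = 1%:M.
  apply/matrixP=> i j; rewrite !ord1 !mxE eqxx -[RHS]p1.
  by apply: eq_bigr => k _; rewrite [X in _ * X]mxE mulr1.
have -> : p *m mxword M w *m col_mx 0 y = x *m mxword B w *m y.
  (* The mass [c] that has leaked into the sink need not be computed: it meets the 0 of
     [col_mx 0 y]. *)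
  have [c ->] : exists c, mxword M w = block_mx 1%:M 0 c (mxword B w).
    elim: w {Mw1} => [|a w [c IHw]] /=.
      by exists 0; rewrite -scalar_mx_block.
    rewrite IHw mulmx_block mul1mx !(mul0mx, mulmx0, addr0, add0r).
    by eexists.
  by rewrite mul_row_block mul_row_col !mulmx0 !add0r.
by rewrite !mxE eqxx mulr1.
Qed.

Lemma PFA_of_nonneg (R : realType) (Sigma : finType) m
    (x : 'rV[R]_m.+1) (B : Sigma -> 'M[R]_m.+1) (y : 'cV[R]_m.+1) :
  (forall j, 0 <= x 0 j) -> (forall a i j, 0 <= B a i j) ->
  exists (P : PFA R Sigma) (a b : R), [/\ 0 < a, 0 < b & forall w,
    acceptance_prob P w = 2^-1 + a * b ^+ size w * (x *m mxword B w *m y) 0 0].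
Proof.
move=> x0 B0.
(* The leading 1 keeps each divisor positive even when all entries vanish. Summing over all letters
   in [s] gives one factor for every [B a], so the scaling depends on [w] only through its
   length. *)
pose r := 1 + \sum_j x 0 j.
pose s := 1 + \sum_a \sum_i \sum_j B a i j.
pose t := 1 + \sum_i `|y i 0|.
have r_gt0 : 0 < r by rewrite ltr_pwDl ?sumr_ge0.
have t_gt0 : 0 < t by rewrite ltr_pwDl ?sumr_ge0.
have row0 a i : 0 <= \sum_j B a i j by exact: sumr_ge0.
have mat0 a : 0 <= \sum_i \sum_j B a i j by exact: sumr_ge0.
have s_gt0 : 0 < s by rewrite ltr_pwDl ?sumr_ge0.
have xr0 j : 0 <= (r^-1 *: x) 0 j by rewrite mxE mulr_ge0 ?invr_ge0 // ltW.
have xr1 : \sum_j (r^-1 *: x) 0 j <= 1.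
  under eq_bigr do rewrite mxE.
  by rewrite -mulr_sumr mulrC ler_pdivrMr // mul1r lerDr.
have Bs0 a i j : 0 <= (s^-1 *: B a) i j.
  by rewrite mxE mulr_ge0 ?invr_ge0 // ltW.
have Bs1 a i : \sum_j (s^-1 *: B a) i j <= 1.
  under eq_bigr do rewrite mxE.
  rewrite -mulr_sumr mulrC ler_pdivrMr // mul1r.
  apply: (@le_trans _ _ (\sum_i \sum_j B a i j)).
    by rewrite [leRHS](bigD1 i) //= lerDl sumr_ge0.
  by rewrite /s (bigD1 a) //= addrCA lerDl addr_ge0 ?sumr_ge0.
have yt1 i : `|(t^-1 *: y) i 0| <= 1.
  rewrite mxE normrM gtr0_norm ?invr_gt0 // mulrC ler_pdivrMr // mul1r.
  by rewrite /t (bigD1 i) //= addrCA lerDl addr_ge0 ?sumr_ge0.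
have [P PE] := PFA_of_substochastic xr0 xr1 Bs0 Bs1 yt1.
exists P, (2^-1 * r^-1 * t^-1), s^-1; split=> [||w].
- by rewrite !mulr_gt0 ?invr_gt0.
- by rewrite invr_gt0.
rewrite PE mxword_scale -!(scalemxAr, scalemxAl) !scalerA mxE.
by congr (_ + _); ring.
Qed.

Lemma PFA_reversal (R : realType) (Sigma : finType) (P : PFA R Sigma)
    (lambda : R) :
  exists Q : PFA R Sigma, forall w,
    acceptance_prob Q w = 2^-1 <-> acceptance_prob P (rev w) = lambda.
Proof.
pose A := pfa_trans P.
pose u : 'cV[R]_(pfa_dim P).+1 := A RightEnd *m \col_i (i \in pfa_accept P)%:R.
(* Index 0 is the self-loop state, with initial weight 1. The possibly negative [- lambda] is its
   final weight, since only [y] may have negative entries. The other block runs [P] backwards, from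
   [u] to the first row of [A LeftEnd]. *)
pose x : 'rV[R]_(1 + (pfa_dim P).+1) := row_mx 1%:M u^T.
pose B (a : Sigma) : 'M[R]_(1 + (pfa_dim P).+1) :=
  block_mx 1%:M 0 0 (A (Letter a))^T.
pose y : 'cV[R]_(1 + (pfa_dim P).+1) :=
  col_mx (- lambda)%:M (row ord0 (A LeftEnd))^T.
have A0 a i j : 0 <= A a i j by case: (pfa_stochastic P a).
have x0 j : 0 <= x 0 j.
  rewrite mxE; case: split => k; rewrite mxE ?ler0n // mxE.
  by apply: sumr_ge0 => i _; rewrite mulr_ge0 // mxE ler0n.
have B0 a i j : 0 <= B a i j.
  by rewrite mxE; case: split => k; rewrite mxE; case: split => l;
    rewrite mxE ?ler0n.
have [Q [a [b [a0 b0 QE]]]] := PFA_of_nonneg y x0 B0.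
exists Q => w; rewrite QE.
have -> : (x *m mxword B w *m y) 0 0 = acceptance_prob P (rev w) - lambda.
  rewrite mxword_block_diag mxword_const1 mul_row_block mul_row_col.
  rewrite !(mul1mx, mulmx1, mulmx0, addr0, add0r) mxword_tr -!trmx_mul.
  by rewrite acceptance_probE mulmxA !mxE addrC eqxx.
(* The factor varies with [w] but never vanishes, which suffices for comparing with 1/2. *)
have ab0 : a * b ^+ size w != 0 by rewrite mulf_neq0 ?expf_neq0 ?gt_eqF.
split=> [|->]; last by rewrite subrr mulr0 addr0.
rewrite -[RHS]addr0 => /addrI/eqP; rewrite mulf_eq0 (negPf ab0) subr_eq0.
by move/eqP.
Qed.

(** As [rev] is an involution, the image under it is also the preimage. *)
Lemma reversal_comprehension (Sigma : finType) (C D : seq Sigma -> Prop) :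
  (forall w, D w <-> C (rev w)) ->
  reversal [set w | C w]%classic = [set w | D w]%classic.
Proof.
move=> DC; apply/seteqP; split=> [_ [w Cw <-]|w /DC Cw] /=.
  by apply/DC; rewrite revK.
by exists (rev w); rewrite ?revK.
Qed.

Theorem theorem5p8 (R : realType) (Sigma : finType) :
  closed_under_reversal (@S_neq R Sigma) /\
  closed_under_reversal (@S_eq R Sigma).
Proof.
have half01 : 0 <= (2^-1 : R) <= 1 by lra.
(* The same [Q] with cutpoint 1/2 serves both classes. *)
split=> _ [P [lambda [_ ->]]]; have [Q QP] := PFA_reversal P lambda;
  exists Q, 2^-1; split=> //; apply: reversal_comprehension => w; last exact: QP.
by split=> PQ /QP.
Qed.
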